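(* Let $G$ be an $n$-vertex graph, where $n$ is odd, which admits $16\, \alpha(G) + 12$ pairwise disjoint connected dominating sets. Then $\mathcal{C}_n(G) = \mathcal{C}(G)$.
   Context: Graphs are finite and simple. $\alpha(G)$ is the independence number of $G$. A connected dominating set (CDS) in a graph $G$ is a set $S \subseteq V(G)$ such that the induced subgraph $G[S]$ is connected and for every vertex $v \in V(G) \setminus S$ there exists a vertex $u \in S$ such that $uv \in E(G)$. The cycle space $\mathcal{C}(G)$ is the vector space over $\mathbb{F}_2$ spanned by the incidence vectors (in $\mathbb{F}_2^{E(G)}$) of the edge-sets of all cycles of $G$. If $G$ has $n$ vertices, $\mathcal{C}_n(G)$ is the subspace of $\mathcal{C}(G)$ spanned by the incidence vectors of the edge-sets of cycles of length $n$ in $G$, i.e. of Hamilton cycles of $G$. *)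

(* Defs.v *)
From HB Require Import structures.
From mathcomp Require Import all_boot all_order all_algebra.

Set Implicit Arguments.
Unset Strict Implicit.
Unset Printing Implicit Defensive.

Import GRing.Theory.

(* A finite simple graph is a symmetric irreflexive relation [e] on a         *)
(* finType [T]; the definitions below do not need these two properties.       *)

Section Graph.
Variables (T : finType) (e : rel T).

Definition independent (S : {set T}) : bool :=
  [forall x in S, forall y in S, ~~ e x y].

Definition independence_number : nat :=
  \max_(S : {set T} | independent S) #|S|.

Definition induced_rel (S : {set T}) : rel T :=
  [rel x y | [&& x \in S, y \in S & e x y]].

Definition connected_set (S : {set T}) : bool :=
  (S != set0) && [forall x in S, forall y in S, connect (induced_rel S) x y].

Definition dominating (S : {set T}) : bool :=
  [forall v, (v \notin S) ==> [exists u in S, e u v]].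

Definition connected_dominating (S : {set T}) : bool :=
  connected_set S && dominating S.

Definition edge_set : {set {set T}} :=
  [set [set p.1; p.2] | p : T * T & e p.1 p.2].

Record edge : predArgType :=
  Edge { edge_val :> {set T}; _ : edge_val \in edge_set }.
HB.instance Definition _ := [isSub for edge_val].
HB.instance Definition _ := [Finite of edge by <:].

(* [ucycle] alone also accepts the empty sequence and, as [e] is symmetric,   *)
(* single edges traversed back and forth, hence the bound on the length.      *)
Definition graph_cycle (c : seq T) : bool := (2 < size c) && ucycleb e c.

Definition cycle_edges (c : seq T) : {set edge} :=
  [set A : edge | val A \in [seq [set x; next c x] | x <- c]].

Definition cycles_of_length (k : nat) : {set {set edge}} :=
  [set cycle_edges c | c : k.-tuple T & graph_cycle c].

Definition cycles : {set {set edge}} :=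
  \bigcup_(k < #|T|.+1) cycles_of_length k.

(* No cycle is lost by bounding the length by #|T|. *)
Lemma cyclesP (F : {set edge}) :
  reflect (exists2 c : seq T, graph_cycle c & F = cycle_edges c)
          (F \in cycles).
Proof.
apply: (iffP bigcupP) => [[k _ /imsetP[c cP ->]]|[c cP ->]].
  by exists c; first by rewrite inE in cP.
have /andP[_ /andP[_ Uc]] := cP.
have ltc : size c < #|T|.+1 by rewrite ltnS -(card_uniqP Uc) max_card.
exists (Ordinal ltc) => //; apply/imsetP.
by exists (in_tuple c); rewrite ?inE.
Qed.

Definition incidence (F : {set edge}) : {ffun edge -> ('F_2)^o} :=
  [ffun A => (A \in F)%:R%R].

Definition incidence_span (C : {set {set edge}}) :
    {vspace {ffun edge -> ('F_2)^o}} :=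
  <<[seq incidence F | F <- enum C]>>%VS.

Definition cycle_space : {vspace {ffun edge -> ('F_2)^o}} :=
  incidence_span cycles.

Definition cycle_space_of_length (k : nat) : {vspace {ffun edge -> ('F_2)^o}} :=
  incidence_span (cycles_of_length k).

End Graph.

(* Main.v *)
Require Import Defs.
From mathcomp Require Import all_boot all_order all_algebra.
From mathcomp Require Import zify.

Set Implicit Arguments.
Unset Strict Implicit.
Unset Printing Implicit Defensive.

(** Write [a] for the independence number.  The argument is by duality: if the
Hamilton cycles do not span the cycle space, a linear functional separates them
from some cycle.  Its values on edges form a labelling [f] with values in
[bool], added by [addb], for which all Hamilton cycles have sum 0 although some
cycle has sum 1 ([span_separation], [cycle_edges_sum]).  The contradiction
comes from cycles of length O(a).

Even cycles of length at most [10 * a] have sum 0 ([even_cycle_sum]).  An even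
cycle consists of two paths of equal length between antipodal vertices.  Join
the i-th inner vertices of the two paths through the i-th of a family of
unused dominating sets.  The resulting ladder is a parity switcher: its two
zigzag paths have the same vertices and ends, they use the same rungs, and they
differ exactly in the edges of the cycle.  The vertices off the ladder still
induce a graph which stays connected when any [a] vertices are removed, since
some dominating set avoids everything deleted; hence by the Chvatal-Erdos
argument ([chvatal_erdos]) both zigzags close up to Hamilton cycles along one
and the same path.  Both Hamilton cycles have sum 0, so the even cycle does.

A shortest cycle [c] of sum 1 is induced, so it has at most [2 * a + 1]
vertices, and it must be odd.  Pass to the complementary labelling
[g = ~~ f]: even cycles up to length [10 * a] still have [g]-sum 0, and now [c]
has [g]-sum 0 too, so that the labels on [c] are the differences of a potential
[h] on its vertices.  A short ear of [c] closes up with one of the two arcs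
between its ends to an even cycle, because [c] is odd; so ears obey the
potential as well ([ear_sum]).  Two short paths from a vertex [v] to [c] that
are disjoint form an ear, and thus predict the same value of the potential at
[v]; two arbitrary ones are compared with a third, disjoint from both, which
exists because deleting few vertices does not disconnect the graph.  So the
potential extends to the whole graph ([potential_extends]) and every closed
walk has [g]-sum 0.  But the [g]-sum of a Hamilton cycle is its [f]-sum plus
its length, that is 0 plus an odd number: a contradiction. *)

(** * Label sums along walks *)

Section WalkSum.
Variables (T : eqType) (g : T -> T -> bool).

Fixpoint walk_sum x p :=
  if p is y :: p' then g x y (+) walk_sum y p' else false.

Lemma walk_sum_cat x p q :
  walk_sum x (p ++ q) = walk_sum x p (+) walk_sum (last x p) q.
Proof. by elim: p x => //= y p IHp x; rewrite IHp addbA. Qed.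

Lemma walk_sum_rcons x p y :
  walk_sum x (rcons p y) = walk_sum x p (+) g (last x p) y.
Proof. by rewrite -cats1 walk_sum_cat /= addbF. Qed.

(** Cuts a cycle into arcs when the walk is closed. *)
Lemma walk_sum_cat_cons x p y q :
  walk_sum x (p ++ y :: q) = walk_sum x (rcons p y) (+) walk_sum y q.
Proof. by rewrite -cat_rcons walk_sum_cat last_rcons. Qed.

Lemma walk_sum_rev x p y : symmetric g ->
  walk_sum y (rcons (rev p) x) = walk_sum x (rcons p y).
Proof.
move=> g_sym; elim: p x => [|z p IHp] x /=; first by rewrite g_sym.
by rewrite rev_cons walk_sum_rcons last_rcons IHp g_sym addbC.
Qed.

(** The sum telescopes. *)
Lemma walk_sum_potential (h : T -> bool) x p :
  path [rel u v | g u v == h u (+) h v] x p ->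
  walk_sum x p = h x (+) h (last x p).
Proof.
elim: p x => [|y p IHp] x /=; first by rewrite addbb.
by case/andP=> /eqP-> /IHp->; rewrite addbA addbK.
Qed.

(** A path carries no cycle, so the values of [h] can be chosen freely from the
last vertex backwards. *)
Lemma walk_has_potential x p : uniq (x :: p) ->
  exists h : T -> bool, path [rel u v | g u v == h u (+) h v] x p.
Proof.
elim: p x => [|y p IHp] x; first by exists xpred0.
case/andP=> xNp /IHp[h hP].
exists (fun z => if z == x then g x y (+) h y else h z) => /=.
have yx : (y == x) = false by apply: contraNF xNp => /eqP<-; rewrite mem_head.
rewrite eqxx yx addbK eqxx /=.
have px z : z \in y :: p -> (z == x) = false.
  by move=> zp; apply: contraNF xNp => /eqP<-.
rewrite (@eq_in_path _ (mem (y :: p)) _ [rel u v | g u v == h u (+) h v]) //.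
  by move=> u v /= /px-> /px->.
by apply/allP.
Qed.

End WalkSum.

(** Complementing the labels adds 1 to every edge, hence the length to the
sum. *)
Lemma walk_sum_negb (T : eqType) (g : T -> T -> bool) x p :
  walk_sum (fun u v => ~~ g u v) x p = walk_sum g x p (+) odd (size p).
Proof.
elim: p x => //= y p IHp x; rewrite IHp.
by case: (g x y); case: (walk_sum _ _ _); case: (odd _).
Qed.

Definition cycle_sum (T : eqType) (g : T -> T -> bool) (c : seq T) :=
  if c is x :: p then walk_sum g x (rcons p x) else false.

(** The shape in which reversals occur when paths are joined at common ends. *)
Lemma path_revE (T : eqType) (e : rel T) x p y : symmetric e ->
  path e y (rcons (rev p) x) = path e x (rcons p y).
Proof.
move=> e_sym; rewrite -rev_cons -(belast_rcons x p y) -{1}(last_rcons x p y).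
by rewrite rev_path; apply: eq_path => u v; rewrite e_sym.
Qed.

Section InducedPaths.
Variables (T : finType) (e : rel T).
Hypotheses (e_sym : symmetric e) (e_irr : irreflexive e).

(** Only the absence of edges between non-consecutive entries is required, so
that this can be combined freely with [path] and [uniq]. *)
Fixpoint chordless (s : seq T) :=
  if s is x :: s' then all (fun z => ~~ e x z) (behead s') && chordless s'
  else true.

Lemma leq_independence S : independent e S -> #|S| <= independence_number e.
Proof. exact: (@leq_bigmax_cond _ (independent e) (fun S => #|S|)). Qed.

(** Take every other entry. *)
Lemma chordless_alternate s : chordless s ->
  exists t, [/\ subseq t s, pairwise (fun u v => ~~ e u v) t
              & size s <= (size t).*2].
Proof.
have [n] := ubnP (size s); elim: n s => // n IHn [|x [|y s]] lt_s /=.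
- by exists [::].
- by exists [:: x]; split=> //=; rewrite eqxx.
case/and3P=> xs _ /IHn[|t [st rt le_t]]; first by move: lt_s => /=; lia.
exists (x :: t); split; rewrite ?eqxx /= ?doubleS ?ltnS //.
  exact: subseq_trans st (subseq_cons _ _).
by rewrite rt andbT; apply/allP=> z /(mem_subseq st) /(allP xs).
Qed.

(** The source of all bounds on the lengths of connecting paths and of a
shortest odd cycle. *)
Lemma chordless_size s :
  uniq s -> chordless s -> size s <= (independence_number e).*2.
Proof.
move=> Us /chordless_alternate[t [st rt /leq_trans-> //]].
rewrite leq_double -(card_uniqP (subseq_uniq st Us)) -cardsE.
apply: leq_independence; move: rt.
rewrite pairwise_all2rel => [/allrelP rt||]; first last.
- by move=> x y; rewrite e_sym.
- by move=> x; rewrite e_irr.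
apply/forall_inP=> x; rewrite inE => xt.
by apply/forall_inP=> y; rewrite inE => yt; apply: rt.
Qed.

(** The middle vertex [z] records that the ends of the chord are not
consecutive, so that taking the chord shortens the walk. *)
Lemma chordP s : ~~ chordless s ->
  exists s1 u z s2 v s3, s = s1 ++ u :: z :: s2 ++ v :: s3 /\ e u v.
Proof.
elim: s => //= x s IHs; rewrite negb_and.
have [/IHs[s1 [u [z [s2 [v [s3 [-> uv]]]]]]] _|_] := boolP (~~ chordless s).
  by exists (x :: s1), u, z, s2, v, s3.
rewrite orbF -has_predC; case: s {IHs} => //= z s /hasP[v /= vs /negbNE xv].
by case/splitPr: vs => s2 s3; exists [::], x, z, s2, v, s3.
Qed.

(** A walk is shortened along repeated vertices and chords until none is
left. *)
Lemma walk_induced_path x p : path e x p ->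
  exists q, [/\ path e x q, last x q = last x p,
    {subset x :: q <= x :: p}, uniq (x :: q) & chordless (x :: q)].
Proof.
have [n] := ubnP (size p); elim: n p => // n IHn p lt_p ep.
have [q [epq <- Uq qp]] : exists q : seq T,
    [/\ path e x q, last x q = last x p, uniq (x :: q) & {subset q <= p}].
  by case/shortenP: ep => q epq Uq qp; exists q.
have sub_q : {subset x :: q <= x :: p}.
  by move=> z; rewrite !inE => /predU1P[->|/qp->]; rewrite ?eqxx ?orbT.
have le_q : size q <= size p.
  by apply: uniq_leq_size => //; case/andP: Uq.
have [cq|/chordP[s1 [u [z [s2 [v [s3 [def_q uv]]]]]]]] := boolP (chordless (x :: q)).
  by exists q.
have [r def_r] : exists r, x :: r = s1 ++ u :: v :: s3.
  by case: s1 def_q => [|x1 s1] [<- _]; [exists (v :: s3)|exists (s1 ++ u :: v :: s3)].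
have er : sorted e (x :: r).
  move: (epq : sorted e (x :: q)); rewrite def_q def_r !sorted_cat_cons /= uv.
  by rewrite cat_path /=; case/and5P=> -> _ _ _ ->.
have last_r : last x r = last x q.
  have lst w t : last x t = last w (x :: t) by [].
  by rewrite (lst x r) (lst x q) def_r def_q !last_cat /= last_cat.
have sub_r : {subset x :: r <= x :: q}.
  move=> w; rewrite def_r def_q !(mem_cat, inE).
  by case/orP=> [->|/or3P[]->]; rewrite ?orbT.
have lt_r : size r < n.
  have := congr1 size def_r; have := congr1 size def_q.
  rewrite /= !size_cat /= size_cat /=; lia.
have [t [et lt st Ut ct]] := IHn r lt_r er.
exists t; split=> //; first by rewrite lt last_r.
by move=> w /st /sub_r /sub_q.
Qed.

Lemma connected_in_path (S : {set T}) x y : connect (induced_rel e S) x y ->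
  x \in S -> exists q, [/\ path e x q, last x q = y, {subset x :: q <= S},
    uniq (x :: q) & size q < (independence_number e).*2].
Proof.
case/connectP=> p Sp -> xS.
have [pS ep] : {subset x :: p <= S} /\ path e x p.
  elim: p x xS Sp => [|z p IHp] x xS /=; first by split=> // w /[!inE]/eqP->.
  case/andP=> /and3P[_ zS xz] /(IHp z zS)[pS ep]; rewrite xz ep; split=> // w.
  by rewrite inE => /predU1P[->|/pS].
have [q [epq lq sq Uq cq]] := walk_induced_path ep; exists q; split=> //.
  by move=> w /sq/pS.
exact: chordless_size Uq cq.
Qed.

End InducedPaths.

(** * Hamilton paths between prescribed ends *)

Section ChvatalErdos.
Variables (T : finType) (e : rel T).
Hypotheses (e_sym : symmetric e) (e_irr : irreflexive e).

Definition connected_in (S : {set T}) :=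
  {in S &, forall x y, connect (induced_rel e S) x y}.

Definition path_in (S : {set T}) a b (P : seq T) :=
  [/\ sorted e P, uniq P, {subset P <= S}, head b P = a & last a P = b].

Lemma next_consecutive (s1 s2 : seq T) x y :
  uniq (s1 ++ x :: y :: s2) -> next (s1 ++ x :: y :: s2) x = y.
Proof.
by move/(next_rot (size s1))=> <-; rewrite rot_size_cat /= eqxx.
Qed.

(** In the application [R] is the part of the graph missed by a path, and the
detour re-enters the path through the component of [v] in [R]. *)
Lemma detour (R : {set T}) v x y u w : u \in R -> w \in R -> v \in R ->
    connect (induced_rel e R) v u -> connect (induced_rel e R) v w ->
    e x u -> e y w ->
  exists q, [/\ path e x (rcons q y), 0 < size q, uniq q & {subset q <= R}].
Proof.
move=> uR wR vR vu vw xu yw.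
have Rsym : connect_sym (induced_rel e R).
  by apply: sym_connect_sym => s t; rewrite /induced_rel /= e_sym andbCA.
have uw : connect (induced_rel e R) u w by rewrite (connect_trans _ vw) // Rsym.
have [q [epq lq sq Uq _]] := connected_in_path e_sym e_irr uw uR.
by exists (u :: q); split=> //=; rewrite xu rcons_path epq lq e_sym.
Qed.

(** One step of the Chvatal-Erdos argument.  The path [P] misses [v]; [H] is
the component of [v] outside [P] and [N] the set of its neighbours on [P].
Either [P] can be rerouted through [H], because two consecutive vertices lie in
[N] or two vertices of [N] have adjacent successors, or [v] and the successors
of [N] form an independent set.  In the second case [N] has at most
[independence_number e] elements, but separates [H] from the rest of [P]. *)
Section Extension.
Variables (S : {set T}) (a b v : T) (P : seq T).
Hypotheses (neq_ab : a != b) (P_path : path_in S a b P) (vS : v \in S).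
Hypothesis (vNP : v \notin P).

Let R := S :\: [set x in P].
Let H := [set z | connect (induced_rel e R) v z].
Let N := [set x in P | [exists z in H, e x z]].

Let longer := exists Q, path_in S a b Q /\ size P < size Q.

Let vR : v \in R. Proof. by rewrite !inE vNP. Qed.

Let HR z : z \in H -> z \in R.
Proof.
rewrite inE => vz.
have [q [_ <- sq _ _]] := connected_in_path e_sym e_irr vz vR.
by apply: sq; rewrite mem_last.
Qed.

Let N_detour x y : x \in N -> y \in N ->
  exists q, [/\ path e x (rcons q y), 0 < size q, uniq q & {subset q <= R}].
Proof.
rewrite !inE => /andP[_ /exists_inP[u uH xu]] /andP[_ /exists_inP[w wH yw]].
by apply: (@detour R v x y u w); rewrite ?HR ?vR //; move: uH wH; rewrite !inE.
Qed.

Let splice q Q : perm_eq Q (P ++ q) -> uniq q -> {subset q <= R} ->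
  0 < size q -> sorted e Q -> head b Q = head b P -> last a Q = last a P ->
  longer.
Proof.
move=> permQ Uq qR q_gt0 eQ hQ lQ; have [eP UP PS hP lP] := P_path.
exists Q; split; last by rewrite (perm_size permQ) size_cat -addn1 leq_add2l.
split=> //; rewrite ?hQ ?lQ //.
  rewrite (perm_uniq permQ) cat_uniq UP Uq andbT; apply/hasPn=> z /qR.
  by rewrite !inE => /andP[].
move=> z; rewrite (perm_mem permQ) mem_cat => /orP[/PS//|/qR].
by rewrite inE => /andP[].
Qed.

Let consecutive_longer s1 x y s2 :
  P = s1 ++ x :: y :: s2 -> x \in N -> y \in N -> longer.
Proof.
move=> defP xN yN; have [q [epq q0 Uq qR]] := N_detour xN yN.
have [eP _ _ _ _] := P_path.
apply: (@splice q (s1 ++ x :: q ++ y :: s2)) => //.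
- apply/permP=> c; rewrite defP /= !count_cat /= !count_cat /=; clear; lia.
- move: eP; rewrite defP !sorted_cat_cons /= -cat_rcons cat_path last_rcons epq.
  by case/and3P=> -> _ ->.
- by rewrite defP; case: s1 {defP}.
- by rewrite defP !last_cat /= last_cat.
Qed.

(* Go through H from x to y, backwards along P to the successor of x, and jump *)
(* to the successor of y.                                                     *)
Let crossing_longer s1 x x' s2 y y' s3 :
  P = s1 ++ x :: x' :: s2 ++ y :: y' :: s3 -> x \in N -> y \in N ->
  e x' y' -> longer.
Proof.
move=> defP xN yN xy'; have [q [epq q0 Uq qR]] := N_detour xN yN.
have [eP _ _ _ _] := P_path.
apply: (@splice q (s1 ++ x :: q ++ y :: rev s2 ++ x' :: y' :: s3)) => //.
- apply/permP=> c; rewrite defP; do !rewrite ?count_cat ?count_rev /=; clear; lia.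
- move: eP; rewrite defP !sorted_cat_cons /= -(cat_rcons y s2) -(cat_rcons y q).
  rewrite -(cat_rcons x' (rev s2)) !cat_path !last_rcons /=.
  rewrite epq (path_revE x' s2 y e_sym) /= xy'.
  by case/and4P=> -> _ -> /andP[_ ->].
- by rewrite defP; case: s1 {defP}.
- by rewrite defP; do !rewrite ?last_cat /=.
Qed.

Let split_before_last x : x \in P -> x != b ->
  exists s1 s2, P = s1 ++ x :: next P x :: s2.
Proof.
have [_ UP _ _ lP] := P_path; case/splitPr defP: {1}P / => [s1 [|y s2]] xb.
  by move: lP xb; rewrite defP last_cat /= => ->; rewrite eqxx.
by exists s1, s2; rewrite defP next_consecutive // -defP.
Qed.

Let ordered_crossing_longer x y : x \in N :\ b -> y \in N :\ b ->
  index x P < index y P -> e (next P x) (next P y) -> longer.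
Proof.
rewrite !in_setD1 => /andP[xb xN] /andP[yb yN] lt_xy.
have inP z : z \in N -> z \in P by rewrite inE => /andP[].
have [s1 [t defP]] := split_before_last (inP x xN) xb.
have [_ UP _ _ _] := P_path.
have : y \in t \/ y = next P x.
  have : y \in P by apply: inP.
  rewrite {1}defP mem_cat !inE => /or4P[ys1|/eqP yx|/eqP->|].
  - move: lt_xy UP; rewrite defP cat_uniq => + /and3P[_ /= xs1 _].
    rewrite !index_cat ys1 (negbTE (_ : x \notin s1)) /= .
      move: ys1; rewrite -index_mem => /ltnW/leq_trans le.
      by rewrite ltnNge le ?leq_addr.
    by apply: contra xs1 => xs1; rewrite xs1.
  - by rewrite yx ltnn in lt_xy.
  - by right.
  - by left.
case=> [/splitPr yt|yx _]; last first.
  by apply: (consecutive_longer defP); rewrite // -yx.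
case: yt defP => t1 [|y' t2] defP.
  move=> _; have [_ _ _ _ lP] := P_path; move: lP yb.
  by rewrite defP; do !rewrite last_cat /=; move=> ->; rewrite eqxx.
have -> : next P y = y'.
  move: UP; rewrite defP -2!cat_cons catA => UP.
  by rewrite (next_consecutive UP).
exact: crossing_longer defP xN yN.
Qed.

(* The end b of P may lie in N without having a successor on P, but v makes up *)
(* for it in the count.                                                        *)
Let few_attachments : #|N| <= independence_number e \/ longer.
Proof.
pose I := v |: next P @: (N :\ b).
have inP z : z \in N -> z \in P by rewrite inE => /andP[].
have [eP UP PS hP lP] := P_path.
have next_v x : x \in N :\ b -> e (next P x) v -> longer.
  rewrite in_setD1 => /andP[xb xN] xv.
  have [s1 [t defP]] := split_before_last (inP x xN) xb.
  apply: (consecutive_longer defP xN).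
  rewrite inE mem_next inP //=; apply/exists_inP; exists v => //.
  by rewrite inE connect0.
have [indI|] := boolP (independent e I).
  left; apply: leq_trans (leq_independence indI); rewrite cardsU1.
  rewrite card_imset; last exact: can_inj (prev_next UP).
  rewrite (cardsD1 b N); case: (boolP (b \in N)) => _ /=; last first.
    by rewrite add0n leq_addl.
  rewrite leq_add2r; case: (boolP (v \in _)) => // /imsetP[x].
  rewrite in_setD1 => /andP[_ /inP xP] vx.
  by case/negP: vNP; rewrite vx mem_next.
rewrite negb_forall_in => /exists_inP[u uI]; rewrite negb_forall_in.
case/exists_inP=> w wI; rewrite negbK => uw; right.
case/setU1P: uI uw => [->|/imsetP[x xN ->]]; case/setU1P: wI => [->|/imsetP[y yN ->]].
- by rewrite e_irr.
- by rewrite e_sym; apply: next_v.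
- exact: next_v.
case: (ltngtP (index x P) (index y P)) => [lt_xy|lt_yx|eq_xy].
- exact: ordered_crossing_longer.
- by rewrite e_sym; apply: ordered_crossing_longer.
have xP : x \in P by apply: inP; case/setD1P: xN.
have yP : y \in P by apply: inP; case/setD1P: yN.
by rewrite -(nth_index a xP) eq_xy nth_index // e_irr.
Qed.

Lemma extend_path :
  (forall X : {set T}, #|X| <= independence_number e -> connected_in (S :\: X)) ->
  exists Q, path_in S a b Q /\ size P < size Q.
Proof.
move=> conn; have [leN|//] := few_attachments.
have [eP UP PS hP lP] := P_path.
have aP : a \in P.
  case: (P) hP lP => [_ ab|x s /= -> _]; rewrite ?mem_head //.
  by move: neq_ab; rewrite -ab eqxx.
have [s1 [s2 defP]] := split_before_last aP neq_ab.
have [[z zP zN]|//] : (exists2 z, z \in P & z \notin N) \/ longer.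
- have [aN|aN] := boolP (a \in N); last by left; exists a.
  have [nN|nN] := boolP (next P a \in N); last first.
    by left; exists (next P a); rewrite ?mem_next.
  by right; apply: consecutive_longer defP aN nN.
- have vz : connect (induced_rel e (S :\: N)) v z.
    apply: conn leN _ _ _ _; first by rewrite !inE (negbTE vNP) vS.
    by rewrite in_setD zN PS.
  (* No edge leaves H once N is removed. *)
  have closedH p u : u \in H -> path (induced_rel e (S :\: N)) u p -> last u p \in H.
    elim: p u => //= w p IHp u uH /andP[/and3P[_ wSN uw]]; apply: IHp.
    have wR : w \in R.
      move: wSN; rewrite !in_setD inE => /andP[wN ->]; rewrite andbT.
      apply: contra wN; rewrite !inE => -> /=.
      by apply/exists_inP; exists u; rewrite // e_sym.
    have uR := HR uH; move: uH; rewrite !inE => /connect_trans; apply.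
    by apply: connect1; apply/and3P.
  case/connectP: vz => p Np zp; have: last v p \in H.
    by apply: closedH Np; rewrite inE connect0.
  by rewrite -zp => /HR; rewrite !inE zP.
Qed.

End Extension.

(** The connectivity hypothesis says that [S] induces an
(independence_number + 1)-connected graph, apart from its size. *)
Theorem chvatal_erdos (S : {set T}) a b : a \in S -> b \in S -> a != b ->
  (forall X : {set T}, #|X| <= independence_number e -> connected_in (S :\: X)) ->
  exists2 P, path_in S a b P & {subset S <= P}.
Proof.
move=> aS bS ab conn.
have [P] : exists P, path_in S a b P.
  have := conn set0; rewrite setD0 cards0 => /(_ isT a b aS bS) c.
  have [q [epq lq sq Uq _]] := connected_in_path e_sym e_irr c aS.
  by exists (a :: q).
have [n] := ubnP (#|S| - size P); elim: n P => // n IHn P lt_n PS.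
have [sub|] := boolP (S \subset [set x in P]).
  by exists P => // x /(subsetP sub); rewrite inE.
case/subsetPn=> v vS; rewrite inE => vP.
have [Q [QS lt_PQ]] := extend_path ab PS vS vP conn.
have [_ UQ QsubS _ _] := QS; apply: IHn QS.
have : size Q <= #|S| by rewrite -(card_uniqP UQ); apply/subset_leq_card/subsetP.
lia.
Qed.

End ChvatalErdos.

(** * Disjoint connected dominating sets and parity switchers *)

Section DisjointCDS.
Variables (T : finType) (e : rel T).
Hypotheses (e_sym : symmetric e) (e_irr : irreflexive e).
Variables (k : nat) (D : 'I_k -> {set T}).
Hypothesis D_cds : forall i, connected_dominating e (D i).
Hypothesis D_disj : forall i j, i != j -> [disjoint D i & D j].

Definition met_by (X : {set T}) := [set i | ~~ [disjoint D i & X]].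

(** Each element of [X] lies in at most one of the disjoint sets [D i]. *)
Lemma card_met_by X : #|met_by X| <= #|X|.
Proof.
pose owner x := [pick i | x \in D i].
have inj_some : injective (@Some 'I_k) by move=> i j [].
rewrite -(card_imset _ inj_some).
apply: leq_trans (leq_imset_card owner X); apply/subset_leq_card/subsetP.
move=> _ /imsetP[i + ->]; rewrite inE => /pred0Pn[x /andP[/= xi xX]].
apply/imsetP; exists x; rewrite // /owner; case: pickP => [j xj|/(_ i)/[!xi]//].
congr Some; apply/eqP; apply: contraT => /D_disj/pred0P/(_ x) /=.
by rewrite xi xj.
Qed.

Lemma unmet_index (J : {set 'I_k}) (X : {set T}) :
  #|J| + #|X| < k -> exists2 i, i \notin J & [disjoint D i & X].
Proof.
move=> ltk; have : ~~ ([set: 'I_k] \subset J :|: met_by X).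
  apply: contraL ltk => /subset_leq_card; rewrite cardsT card_ord -leqNgt.
  move=> /leq_trans; apply; apply: leq_trans (leq_card_setU _ _) _.
  by rewrite leq_add2l card_met_by.
case/subsetPn=> i _; rewrite !inE negb_or negbK => /andP[iJ iX].
by exists i.
Qed.

Lemma connected_in_cds i x y : x \in D i -> y \in D i ->
  connect (induced_rel e (D i)) x y.
Proof.
have /andP[/andP[_ /forall_inP conn] _] := D_cds i.
by move=> /conn/forall_inP; apply.
Qed.

Lemma dominated i x : x \notin D i -> exists2 u, u \in D i & e u x.
Proof.
by have /andP[_ /forall_inP dom] := D_cds i; move=> /dom/exists_inP.
Qed.

(** Every vertex of [S] is in [D i] or adjacent to it. *)
Lemma connected_above_cds i (S : {set T}) : D i \subset S -> connected_in e S.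
Proof.
move=> DS x y xS yS; have DSP := subsetP DS.
have Ssym : connect_sym (induced_rel e S).
  by apply: sym_connect_sym => s t; rewrite /induced_rel /= e_sym andbCA.
have enter z : z \in S -> exists2 u, u \in D i & connect (induced_rel e S) z u.
  move=> zS; have [zD|/dominated[u uD uz]] := boolP (z \in D i).
    by exists z; rewrite ?connect0.
  by exists u => //; apply/connect1/and3P; rewrite e_sym; split=> //; apply: DSP.
have [[u uD xu] [w wD yw]] := (enter x xS, enter y yS).
apply: connect_trans xu _; apply: connect_trans (_ : connect _ u w) _; last first.
  by rewrite Ssym.
apply: connect_sub (connected_in_cds uD wD) => s t /and3P[sD tD st].
by apply/connect1/and3P; rewrite !DSP.
Qed.

Lemma connected_avoiding (X : {set T}) : #|X| < k -> connected_in e (~: X).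
Proof.
move=> ltX; have [|i _ iX] := @unmet_index set0 X; first by rewrite cards0.
by apply: (@connected_above_cds i); rewrite -disjoints_subset.
Qed.

Lemma cds_link i x y : x \notin D i -> y \notin D i ->
  exists q, [/\ path e x (rcons q y), uniq q & {subset q <= D i}].
Proof.
move=> /dominated[u uD ux] /dominated[w wD wy].
have [q [qe lq sq Uq _]] :=
  connected_in_path e_sym e_irr (connected_in_cds uD wD) uD.
by exists (u :: q); split=> //=; rewrite rcons_path qe lq e_sym ux wy.
Qed.

(** A ladder is a sequence of rungs [(x, q, y)]: the vertices [x] and [y] lie
on the left and on the right rail, and [q] is the interior of a path joining
them. *)
Local Notation rung := (T * seq T * T)%type.

Definition left_rail (s : seq rung) := [seq t.1.1 | t <- s].
Definition right_rail (s : seq rung) := [seq t.2 | t <- s].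
Definition rung_interiors (s : seq rung) := flatten [seq t.1.2 | t <- s].
Definition rungs_ok (s : seq rung) :=
  all (fun t => path e t.1.1 (rcons t.1.2 t.2)) s.

(** Preceded and followed by a common end of the two rails, these are the two
Hamilton paths of the ladder. *)
Fixpoint zigzag (left : bool) (s : seq rung) : seq T :=
  if s is (x, q, y) :: s' then
    if left then x :: q ++ y :: zigzag false s'
    else y :: rev q ++ x :: zigzag true s'
  else [::].

Lemma perm_zigzag l s :
  perm_eq (zigzag l s) (left_rail s ++ right_rail s ++ rung_interiors s).
Proof.
elim: s l => [|[[x q] y] s IHs] l //=; apply/permP => c; move: (IHs (~~ l)).
move=> /permP/(_ c); rewrite /rung_interiors /= !count_cat.
by case: l => /=; do !rewrite ?count_cat ?count_rev /=; lia.
Qed.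

(** The induction changes the starting points [u] and [w] of the two rails at
each rung, so they are kept independent of each other. *)
Lemma zigzag_path b s u w : rungs_ok s ->
    path e u (rcons (left_rail s) b) -> path e w (rcons (right_rail s) b) ->
  path e u (rcons (zigzag true s) b) /\ path e w (rcons (zigzag false s) b).
Proof.
elim: s u w => [|[[x q] y] s IHs] u w //= /andP[/= xqy oks].
case/andP=> ux xs /andP[wy ys]; have [xz yz] := IHs x y oks xs ys.
rewrite !rcons_cat /= -(cat_rcons y q) -(cat_rcons x (rev q)) !cat_path.
by rewrite !last_rcons ux wy path_revE // xqy.
Qed.

(** The two zigzags cross each rung in opposite directions, so the rungs cancel
and every rail edge remains exactly once. *)
Lemma zigzag_sum f b s u w : symmetric f ->
  walk_sum f u (rcons (zigzag true s) b) (+)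
    walk_sum f w (rcons (zigzag false s) b) =
  walk_sum f u (rcons (left_rail s) b) (+)
    walk_sum f w (rcons (right_rail s) b).
Proof.
move=> f_sym; elim: s u w => [|[[x q] y] s IHs] u w //=.
rewrite !rcons_cat /= !(walk_sum_cat_cons f _ _ _ (rcons _ b)) walk_sum_rev //.
have := IHs x y.
by do ?case: (walk_sum _ _ _); case: (f u x); case: (f w y).
Qed.

Lemma rungs_exist xs ys (js : seq 'I_k) :
    size ys = size xs -> size js = size xs -> uniq js ->
    {in js & xs ++ ys, forall i z, z \notin D i} ->
  exists s, [/\ left_rail s = xs, right_rail s = ys, rungs_ok s,
    uniq (rung_interiors s)
    & {in rung_interiors s, forall z, exists2 i, i \in js & z \in D i}].
Proof.
elim: xs ys js => [|x xs IHxs] [|y ys] [|j js] //=; first by exists [::].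
move=> [sz_ys] [sz_js] /andP[jNjs Ujs] out.
have [|s [xsE ysE oks Us sD]] := IHxs ys js sz_ys sz_js Ujs.
  move=> i z ijs z_xys; apply: out; rewrite inE ?ijs ?orbT //.
  by move: z_xys; rewrite !(mem_cat, inE) => /orP[->|->]; rewrite ?orbT.
have [||q [qe Uq qD]] := @cds_link j x y.
- by apply: out; rewrite !(mem_cat, inE) eqxx.
- by apply: out; rewrite !(mem_cat, inE) eqxx ?orbT.
exists ((x, q, y) :: s); rewrite /= xsE ysE qe oks; split=> //.
  rewrite [rung_interiors _]/= cat_uniq Uq [uniq (flatten _)]Us andbT.
  apply/hasPn=> z /sD[i ijs zi]; apply/negP=> /qD zj.
  have ij : i != j by apply: contraNneq jNjs => <-.
  by have /pred0P/(_ z) := D_disj ij; rewrite /= zi zj.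
move=> z; rewrite [rung_interiors _]/= mem_cat => /orP[/qD zj|/sD[i ijs zi]].
  by exists j; rewrite ?mem_head.
by exists i; rewrite // inE ijs orbT.
Qed.

Section Switching.
Variable f : T -> T -> bool.
Hypothesis f_sym : symmetric f.
Hypothesis f_hamilton : forall c,
  cycle e c -> uniq c -> size c = #|T| -> cycle_sum f c = false.

(** Some [D i] avoids the rails, the rungs and any given set of
[independence_number e] vertices, so [chvatal_erdos] applies to what the inner
vertices of the ladder leave over. *)
Lemma ladder_complement (js : seq 'I_k) a b s :
    let C := a :: b :: left_rail s ++ right_rail s in
    uniq C -> size js + size C + independence_number e < k ->
    {in rung_interiors s, forall z, exists2 i, i \in js & z \in D i} ->
    {in js & C, forall i z, z \notin D i} ->
  exists r, [/\ path e a (rcons r b), uniq (a :: rcons r b)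
    & forall z, (z \in a :: rcons r b) = (z \notin zigzag true s)].
Proof.
move=> C UC ltk sD outD; pose S := ~: [set z in zigzag true s].
have zigE z : z \in zigzag true s =
    [|| z \in left_rail s, z \in right_rail s | z \in rung_interiors s].
  by rewrite (perm_mem (perm_zigzag true s)) !mem_cat.
have endS z : z \in [:: a; b] -> z \in S.
  move=> z_ab; rewrite !inE zigE; apply/negP.
  have zNr : z \notin left_rail s ++ right_rail s.
    move: UC z_ab; rewrite /= !inE => /and3P[/norP[_ aN] bN _].
    by case/orP=> /eqP->.
  move: zNr; rewrite mem_cat => /norP[/negbTE-> /negbTE->] /= /sD[i ijs].
  by apply/negP; apply: outD ijs _; move: z_ab; rewrite !inE => /orP[]->; rewrite ?orbT.
have ab : a != b by move: UC; rewrite /= inE => /andP[/norP[]].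
have [X leX| P [eP UP PS hP lP] SP] :=
  chvatal_erdos e_sym e_irr (endS a (mem_head _ _)) (endS b (mem_last a [:: b])) ab.
  have [|i] := @unmet_index [set j in js] ([set z in C] :|: X).
    apply: leq_ltn_trans ltk; rewrite -addnA; apply: leq_add.
      by rewrite cardsE card_size.
    apply: leq_trans (leq_card_setU _ _) _; rewrite leq_add // cardsE.
    exact: card_size.
  rewrite inE => iNjs disj; apply: (@connected_above_cds i).
  apply/subsetP=> z zi; have := disjointFr disj zi.
  rewrite 5!inE => /norP[/norP[_ /norP[_ zNC]] zNX].
  rewrite !inE zNX zigE orbA -mem_cat negb_or zNC.
  apply/negP=> /sD[j jjs zj].
  have ij : i != j by apply: contraNneq iNjs => ->.
  by have /pred0P/(_ z) := D_disj ij; rewrite /= zi zj.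
have [r defP] : exists r, P = a :: rcons r b.
  case: P hP lP {eP UP PS SP} => [/= ba|x P /= ->]; first by rewrite ba eqxx in ab.
  case/lastP: P => [/= ba|r y]; first by rewrite ba eqxx in ab.
  by rewrite last_rcons => ->; exists r.
exists r; rewrite -defP; split=> //; first by rewrite defP in eP.
move=> z; transitivity (z \in S); last by rewrite !inE.
by apply/idP/idP=> [/PS|/SP].
Qed.

(** The switcher: of the [k] dominating sets, at most [2 * size xs + 2] are
lost because they meet the two paths, [size xs] serve as rungs, and
[independence_number e] must remain to be removed. *)
Lemma switch_path_sum a b xs ys :
    path e a (rcons xs b) -> path e a (rcons ys b) ->
    uniq (a :: b :: xs ++ ys) -> size ys = size xs ->
    3 * size xs + 2 + independence_number e < k ->
  walk_sum f a (rcons xs b) = walk_sum f a (rcons ys b).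
Proof.
move=> exs eys UC sz_ys ltk; set C := a :: b :: xs ++ ys.
have szC : size C = 2 * size xs + 2 by rewrite /= size_cat sz_ys; lia.
have [js [Ujs sz_js out]] : exists js : seq 'I_k,
    [/\ uniq js, size js = size xs & {in js & C, forall i z, z \notin D i}].
  pose J := ~: met_by [set z in C].
  have leJ : size xs <= #|J|.
    have le_met : #|met_by [set z in C]| <= 2 * size xs + 2.
      by apply: leq_trans (card_met_by _) _; rewrite cardsE -szC card_size.
    have := cardsC (met_by [set z in C]); rewrite card_ord -/J => defk.
    by rewrite -(leq_add2l #|met_by [set z in C]|) defk; lia.
  exists (take (size xs) (enum J)); rewrite take_uniq ?enum_uniq //; split=> //.
    by rewrite size_takel // -cardE.
  move=> i z /mem_take; rewrite mem_enum in_setC [i \in _]inE negbK => iC zC.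
  by apply/negP=> zi; have := disjointFr iC zi; rewrite inE zC.
have [|s [xsE ysE oks Us sD]] := rungs_exist sz_ys sz_js Ujs.
  by move=> i z ijs zxy; apply: out; rewrite // !inE zxy !orbT.
have UC' : uniq (a :: b :: left_rail s ++ right_rail s) by rewrite xsE ysE.
have [||r [er Ur rE]] := ladder_complement UC' _ sD.
- by rewrite xsE ysE sz_js szC; lia.
- by move=> i z; rewrite xsE ysE; apply: out.
pose ham l := a :: zigzag l s ++ b :: rev r.
have zig_path l : path e a (rcons (zigzag l s) b).
  by have [|//|pt pf] := @zigzag_path b s a a oks; rewrite ?xsE ?ysE //; case: l.
have zig_uniq : uniq (zigzag true s).
  have Uxy : uniq (left_rail s ++ right_rail s) by case/and3P: UC'.
  rewrite (perm_uniq (perm_zigzag true s)) catA cat_uniq Us Uxy /= andbT.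
  apply/hasPn=> z /sD[i ijs zi].
  apply: contraL zi => zxy; apply: out; rewrite // !inE -xsE -ysE zxy.
  by rewrite !orbT.
have ham_perm l : perm_eq (ham l) (zigzag true s ++ a :: rcons r b).
  have := perm_zigzag true s; have := perm_zigzag l s.
  move=> /permP zl /permP zt; apply/permP=> c; rewrite /ham -cats1.
  by do !rewrite ?count_cat ?count_rev /=; rewrite zl zt; clear; lia.
have ham_uniq l : uniq (ham l).
  rewrite (perm_uniq (ham_perm l)) cat_uniq zig_uniq Ur andbT.
  by apply/hasPn=> z; rewrite rE.
have ham_size l : size (ham l) = #|T|.
  rewrite -(card_uniqP (ham_uniq l)); apply: eq_card => z.
  by rewrite (perm_mem (ham_perm l)) mem_cat rE orbN.
have ham_sum l : walk_sum f a (rcons (zigzag l s) b) = walk_sum f a (rcons r b).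
  have : cycle_sum f (ham l) = false.
    apply: f_hamilton => //; rewrite /= rcons_cat -cat_rcons cat_path.
    by rewrite zig_path last_rcons path_revE.
  rewrite /= rcons_cat walk_sum_cat_cons walk_sum_rev //.
  by do 2!case: (walk_sum _ _ _).
have := zigzag_sum b s a a f_sym; rewrite !ham_sum addbb xsE ysE.
by do 2!case: (walk_sum _ _ _).
Qed.

(** With [m] inner vertices on each half of the cycle and [a] the independence
number, [2 * m + 2 <= 10 * a] gives [3 * m + 2 + a < 16 * a], which is the budget
of [switch_path_sum]. *)
Lemma even_cycle_sum c : 16 * independence_number e <= k ->
    cycle e c -> uniq c -> ~~ odd (size c) ->
    size c <= 10 * independence_number e ->
  cycle_sum f c = false.
Proof.
move=> lek; case: c => [//|a p]; rewrite /cycle => ep Up /=.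
set m := (size p)./2; rewrite negbK => odd_p le_p.
have sz_p : size p = m.*2.+1 by rewrite -[LHS]odd_double_half odd_p.
have sz_xs : size (take m p) = m by rewrite size_takel // sz_p; lia.
case def_d: (drop m p) (size_drop m p) => [|b ys] /=; first by rewrite sz_p; lia.
rewrite sz_p => sz_ys; have defp : p = take m p ++ b :: ys.
  by rewrite -def_d cat_take_drop.
move: ep Up; rewrite defp rcons_cat /= -cat_rcons cat_path last_rcons.
set xs := take m p in sz_xs *; case/andP=> exs eys Up.
rewrite walk_sum_cat last_rcons -(revK ys) walk_sum_rev //.
rewrite (@switch_path_sum a b xs (rev ys)) ?addbb ?size_rev //.
- by rewrite -path_revE // revK.
- move: Up; congr is_true; rewrite -!cons_uniq; apply: perm_uniq.
  by apply/permP=> c; rewrite /= !count_cat /= count_rev; lia.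
- by rewrite sz_xs; lia.
by rewrite sz_xs; lia.
Qed.

End Switching.
End DisjointCDS.

(** * Short odd cycles and potentials *)

Section ShortOddCycle.
Variables (T : finType) (e : rel T) (f : T -> T -> bool).
Hypotheses (e_sym : symmetric e) (e_irr : irreflexive e) (f_sym : symmetric f).

(** A chord splits a cycle into two shorter ones whose sums add up to the sum
of the cycle.  Without chords, all but one vertex of the cycle form an induced
path. *)
Lemma short_odd_cycle c : cycle e c -> uniq c -> 2 < size c -> cycle_sum f c ->
  exists c', [/\ cycle e c', uniq c', 2 < size c', cycle_sum f c'
    & size c' <= (independence_number e).*2.+1].
Proof.
have [n] := ubnP (size c); elim: n c => // n IHn [//|x p] lt_p ec Uc gt2 fc.
have [cp|/chordP[s1 [u [z [s2 [v [s3 [defp uv]]]]]]]] := boolP (chordless e p).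
  exists (x :: p); split=> //=; rewrite ltnS.
  by apply: chordless_size => //; case/andP: Uc.
pose c1 := u :: z :: rcons s2 v; pose c2 := x :: s1 ++ u :: v :: s3.
have [ec1 ec2] : cycle e c1 /\ cycle e c2.
  move: ec; rewrite defp /cycle /c1 /c2 /= !(rcons_cat, rcons_cons) /=.
  rewrite !(rcons_path, cat_path) /= !(rcons_path, cat_path) /= last_rcons.
  rewrite (e_sym v u) uv rcons_path.
  by case/and5P=> -> -> -> -> /and3P[-> -> ->].
have sub21 : uniq c1 && uniq c2.
  move: Uc; rewrite defp /c1 /c2; apply: contraTT; rewrite negb_and => /orP[].
    apply: contra => U; apply: subseq_uniq U; rewrite -cats1.
    apply: subseq_trans (subseq_cons _ _); apply: subseq_trans (suffix_subseq s1 _).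
    by rewrite /= !eqxx; apply: cat_subseq; rewrite //= eqxx sub0seq.
  apply: contra => U; apply: subseq_uniq U; rewrite -!cat_cons.
  apply: cat_subseq => //; apply: (@cat_subseq _ [:: u] _ [:: u]) => //.
  exact: (suffix_subseq (z :: s2)).
have sz : size (x :: p) = (size s1 + size s2 + size s3 + 4)%N.
  by rewrite defp; do !rewrite ?size_cat /=; lia.
have fE : cycle_sum f (x :: p) = cycle_sum f c1 (+) cycle_sum f c2.
  rewrite /= defp !(rcons_cat, rcons_cons) /=.
  rewrite !(walk_sum_cat_cons f x) /= !(walk_sum_cat_cons f z).
  rewrite (walk_sum_rcons f z (rcons s2 v)) last_rcons (f_sym v u).
  case: (f u v); case: (f u z); case: (walk_sum f x _);
    by case: (walk_sum f z _); case: (walk_sum f v _).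
have [U1 U2] := andP sub21; case/boolP: (cycle_sum f c1) => f1.
  apply: (IHn c1 _ ec1 U1 _ f1); last by rewrite /c1 /= size_rcons.
  by move: lt_p; rewrite sz /c1 /= size_rcons; clear; lia.
have {}f1 : cycle_sum f c2 by move: fc; rewrite fE (negbTE f1).
apply: (IHn c2 _ ec2 U2 _ f1); last by rewrite /c2 /= size_cat /= !addnS.
by move: lt_p; rewrite sz /c2 /= size_cat /=; clear; lia.
Qed.

End ShortOddCycle.

Section Potential.
Variables (T : finType) (e : rel T).
Hypotheses (e_sym : symmetric e) (e_irr : irreflexive e).
Variable k : nat.
Hypothesis conn : forall X : {set T}, #|X| < k -> connected_in e (~: X).
Local Notation a := (independence_number e).
Hypothesis k_large : 4 * a < k.
Variable g : T -> T -> bool.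
Hypothesis g_sym : symmetric g.
Hypothesis g_even : forall c, cycle e c -> uniq c -> ~~ odd (size c) ->
  size c <= 10 * a -> cycle_sum g c = false.
Variable c : seq T.
Hypotheses (ec : cycle e c) (Uc : uniq c) (c_gt2 : 2 < size c).
Hypotheses (odd_c : odd (size c)) (c_short : size c <= a.*2.+1).
Hypothesis gc : cycle_sum g c = false.

(** The edge that closes the cycle agrees with the potential of the path since
the total is 0. *)
Lemma cycle_potential :
  exists h : T -> bool, cycle [rel u v | g u v == h u (+) h v] c.
Proof.
case: c Uc gc => [|x p] Ux gx; first by exists xpred0.
have [h hP] := walk_has_potential g Ux; exists h; rewrite /= rcons_path hP /=.
move: gx; rewrite /= walk_sum_rcons (walk_sum_potential hP).
by case: (h x); case: (h _); case: (g _ x).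
Qed.

Variable h : T -> bool.
Hypothesis hP : cycle [rel u v | g u v == h u (+) h v] c.

(** The two arcs of [c] between [u] and [w] have lengths of different parity,
so one of them forms an even cycle with the ear; and both have the sum
prescribed by [h].  That cycle has at most [6 * a] vertices. *)
Lemma ear_sum u w (q : seq T) : u \in c -> w \in c -> u != w ->
    path e u (rcons q w) -> uniq q -> ~~ has (mem c) q -> size q < 4 * a ->
  walk_sum g u (rcons q w) = h u (+) h w.
Proof.
move=> uc wc uw eq_ Uq qNc lt_q; have [i p defc] := rot_to uc.
have ec' : cycle e (u :: p) by rewrite -defc rot_cycle.
have hP' : cycle [rel u v | g u v == h u (+) h v] (u :: p).
  by rewrite -defc rot_cycle.
have Up : uniq (u :: p) by rewrite -defc rot_uniq.
have szp : size (u :: p) = size c by rewrite -defc size_rot.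
have qNp : ~~ has (mem (u :: p)) q.
  by rewrite (eq_has (a2 := mem c)) // => z; rewrite /= -defc mem_rot.
have wp : w \in p.
  by move: wc; rewrite -(mem_rot i) defc inE eq_sym (negbTE uw).
case/splitPr: wp ec' hP' Up szp qNp {defc} => A B ec' hP' Up szp qNp.
move: ec' hP'; rewrite /cycle !rcons_cat /= -!cat_rcons !cat_path !last_rcons.
case/andP=> eA eB /andP[/walk_sum_potential hA /walk_sum_potential hB].
rewrite last_rcons in hA; rewrite last_rcons in hB.
have perm1 : perm_eq ((u :: A ++ w :: B) ++ q) ((u :: A ++ w :: rev q) ++ B).
  by apply/permP=> d; do !rewrite ?count_cat ?count_rev /=; clear; lia.
have perm2 : perm_eq ((u :: A ++ w :: B) ++ q) ((u :: q ++ w :: B) ++ A).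
  by apply/permP=> d; do !rewrite ?count_cat ?count_rev /=; clear; lia.
have Uall : uniq ((u :: A ++ w :: B) ++ q) by rewrite cat_uniq Up qNp Uq.
have {perm1} U1 : uniq (u :: A ++ w :: rev q).
  by move: Uall; rewrite (perm_uniq perm1) cat_uniq => /andP[].
have {perm2} U2 : uniq (u :: q ++ w :: B).
  by move: Uall; rewrite (perm_uniq perm2) cat_uniq => /andP[].
rewrite /= size_cat /= in szp.
have [odd_Aq|even_Aq] := boolP (odd (size A + size q)).
  have : cycle_sum g (u :: q ++ w :: B) = false.
    apply: g_even => //.
    - by rewrite /= rcons_cat /= -cat_rcons cat_path eq_ last_rcons.
    - rewrite /= size_cat /= addnS /= negbK; move: odd_c odd_Aq.
      by rewrite -szp addnS /= negbK !oddD; do 3!case: (odd _).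
    - by rewrite /= size_cat /=; move: c_short lt_q; rewrite -szp; clear; lia.
  rewrite /= rcons_cat walk_sum_cat_cons hB.
  by case: (walk_sum g u _); case: (h u); case: (h w).
have : cycle_sum g (u :: A ++ w :: rev q) = false.
  apply: g_even => //.
  - by rewrite /= rcons_cat /= -cat_rcons cat_path eA last_rcons path_revE.
  - by rewrite /= size_cat /= size_rev addnS /= negbK.
  - rewrite /= size_cat /= size_rev; move: c_short lt_q; rewrite -szp.
    by clear; lia.
rewrite /= rcons_cat walk_sum_cat_cons hA walk_sum_rev //.
by case: (walk_sum g u _); case: (h u); case: (h w).
Qed.

(** Only the interior [s] of the path from [v] to [w] is recorded; [w] is its
first vertex on [c]. *)
Definition attaches v (s : seq T) w :=
  [/\ path e v (rcons s w), uniq (v :: s), ~~ has (mem c) (v :: s),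
      w \in c & size s < a.*2].

(** The value of a potential at [v] that this path dictates. *)
Definition attached_value v (s : seq T) w := walk_sum g v (rcons s w) (+) h w.

(** The bound on [s] is stricter by one than in [attaches], which leaves room
for prolonging the path by one vertex in [potential_extends]. *)
Lemma attachment_avoiding (X : {set T}) (v x : T) :
    v \notin c -> v \notin X -> #|X| < k -> x \in c -> x \notin X ->
  exists (s : seq T) w, [/\ attaches v s w, (size s).+1 < a.*2
    & {in rcons s w, forall z, z \notin X}].
Proof.
move=> vNc vNX ltX xc xNX.
have vx : connect (induced_rel e (~: X)) v x by apply: conn; rewrite ?in_setC.
have [|q [qe lq sq Uq ltq]] := connected_in_path e_sym e_irr vx.
  by rewrite in_setC.
have : has (mem c) q.
  apply/hasP; exists x => //; move: (mem_last v q); rewrite lq inE.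
  by case/predU1P=> // xv; rewrite -xv xc in vNc.
move=> c_q; case: (split_find c_q) qe sq Uq ltq => w s t wc sNc.
rewrite cat_path size_cat size_rcons => /andP[qe _] sq.
rewrite -cat_cons cat_uniq -rcons_cons rcons_uniq => /andP[/andP[_ Us] _] ltq.
have lts : (size s).+1 < a.*2 by apply: leq_trans ltq; rewrite ltnS leq_addr.
exists s, w; split=> //.
  by split; rewrite //= ?negb_or ?vNc // ltnW.
by move=> z zs; rewrite -in_setC sq // inE mem_cat zs orbT.
Qed.

(** The two paths together are an ear of [c] through [v]. *)
Lemma attached_value_disjoint v (s : seq T) w (s' : seq T) w' :
    attaches v s w -> attaches v s' w' -> w != w' -> ~~ has (mem s) s' ->
  attached_value v s w = attached_value v s' w'.
Proof.
move=> [se Us sNc wc lts] [s'e Us' s'Nc w'c lts'] ww' disj.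
have : walk_sum g w (rcons (rev s ++ v :: s') w') = h w (+) h w'.
  apply: ear_sum => //.
  - by rewrite rcons_cat /= -cat_rcons cat_path last_rcons path_revE // se.
  - have -> : uniq (rev s ++ v :: s') = uniq ((v :: s) ++ s').
      apply: perm_uniq; apply/permP=> d.
      by rewrite !count_cat /= count_rev; clear; lia.
    have [vs' Us'_tail] : v \notin s' /\ uniq s' by apply/andP.
    rewrite cat_uniq Us Us'_tail /= andbT.
    apply/hasPn=> z zs'; rewrite inE negb_or (hasPn disj) // andbT.
    by apply: contraNneq vs' => <-.
  - rewrite has_cat has_rev negb_or s'Nc andbT.
    by move: sNc; rewrite /= negb_or => /andP[].
  by rewrite size_cat size_rev /=; move: lts lts'; clear; lia.
rewrite rcons_cat walk_sum_cat_cons walk_sum_rev // /attached_value.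
case: (walk_sum g v (rcons s w)); case: (walk_sum g v (rcons s' w'));
  by case: (h w); case: (h w').
Qed.

(** A third path avoiding both given ones is disjoint from each of them; it can
end on [c] elsewhere as [c] has at least three vertices. *)
Lemma attached_value_unique v (s : seq T) w (s' : seq T) w' :
    attaches v s w -> attaches v s' w' ->
  attached_value v s w = attached_value v s' w'.
Proof.
move=> vsw vsw'; have [_ Us sNc wc lts] := vsw.
have [_ Us' s'Nc w'c lts'] := vsw'.
pose X := [set z in rcons s w ++ rcons s' w'].
have ltX : #|X| < k.
  apply: leq_ltn_trans k_large; rewrite cardsE; apply: leq_trans (card_size _) _.
  by rewrite size_cat !size_rcons; move: lts lts'; clear; lia.
have vNc : v \notin c by move: sNc; rewrite /= negb_or => /andP[].
have [x xc xNX] : exists2 x, x \in c & x \notin X.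
  have /subsetPn[x] : ~~ ([set z in c] \subset [set w; w']).
    apply: contraL c_gt2 => /subset_leq_card; rewrite cardsE (card_uniqP Uc).
    by rewrite -leqNgt => /leq_trans-> //; rewrite cards2; case: (w != w').
  rewrite !inE negb_or => xc /andP[xw xw']; exists x => //.
  rewrite !(inE, mem_cat, mem_rcons) !negb_or xw xw' /=.
  apply/andP; split.
    by apply: contra sNc => xs; apply/hasP; exists x; rewrite ?inE ?xs ?orbT.
  by apply: contra s'Nc => xs; apply/hasP; exists x; rewrite ?inE ?xs ?orbT.
have vNX : v \notin X.
  have vw z : z \in c -> v != z by apply: contraTneq => <-.
  rewrite !(inE, mem_cat, mem_rcons) !negb_or !vw //=.
  by case/andP: Us => -> _; case/andP: Us' => -> _.
have [t [y [vty _ tyX]]] := attachment_avoiding vNc vNX ltX xc xNX.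
have outX z : z \in rcons t y -> z \notin rcons s w /\ z \notin rcons s' w'.
  by move/tyX; rewrite !inE mem_cat => /norP[].
have [yX yX'] : y \notin rcons s w /\ y \notin rcons s' w'.
  by apply: outX; rewrite mem_rcons mem_head.
move: yX yX'; rewrite !mem_rcons !inE => /norP[yw ys] /norP[yw' ys'].
have t_out z : z \in t -> z \notin s /\ z \notin s'.
  move=> zt; have [|zs zs'] := outX z; first by rewrite mem_rcons inE zt orbT.
  by move: zs zs'; rewrite !mem_rcons !inE => /norP[_ ->] /norP[_ ->].
transitivity (attached_value v t y).
  apply: attached_value_disjoint; rewrite // 1?eq_sym //.
  by apply/hasPn=> z /t_out[].
apply/esym/attached_value_disjoint; rewrite // 1?eq_sym //.
by apply/hasPn=> z /t_out[].
Qed.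

(** Off [c], the potential is the common value dictated by all attachments.
Along an edge it changes correctly because an attachment of one end, prolonged
by the edge, is an attachment of the other end. *)
Lemma potential_extends :
  exists h' : T -> bool, forall x y, e x y -> g x y = h' x (+) h' y.
Proof.
have a_gt0 : 0 < a.
  by move: c_gt2 c_short; clear; lia.
have [h' h'P] : exists h' : T -> bool, forall v,
    if v \in c then h' v = h v
    else forall s w, attaches v s w -> attached_value v s w = h' v.
  apply: (fin_all_exists (P := fun v b => if v \in c then b = h v
    else forall s w, attaches v s w -> attached_value v s w = b)) => v.
  have [vc|vNc] := boolP (v \in c); first by exists (h v).
  have [x xc] : exists x, x \in c.
    by case: c c_gt2 => // x p _; exists x; rewrite mem_head.
  have [|||s [w [vsw _ _]]] := @attachment_avoiding set0 v x vNc _ _ xc.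
  - by rewrite inE.
  - by rewrite cards0; apply: leq_ltn_trans k_large.
  - by rewrite inE.
  by exists (attached_value v s w) => s' w' /attached_value_unique; apply.
have in_c v : v \in c -> h' v = h v by move=> vc; have := h'P v; rewrite vc.
have out_c v s w : attaches v s w -> h' v = attached_value v s w.
  move=> vsw; have := h'P v; have [_ _ + _ _] := vsw.
  by rewrite /= negb_or => /andP[/negbTE-> _] ->.
have one x y : x \notin c -> y \in c -> e x y -> g x y = h' x (+) h' y.
  move=> xNc yc xy; have /out_c-> : attaches x [::] y.
    by split; rewrite //= ?xy ?orbF ?double_gt0.
  by rewrite (in_c y yc) /attached_value /= addbF addbK.
exists h' => x y xy.
have [xc|xNc] := boolP (x \in c); have [yc|yNc] := boolP (y \in c).
- have neq_xy : x != y by apply: contraTneq xy => ->; rewrite e_irr.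
  rewrite !in_c //; have := @ear_sum x y [::] xc yc neq_xy.
  by rewrite /= xy addbF muln_gt0 a_gt0; apply.
- by rewrite g_sym addbC; apply: one; rewrite // e_sym.
- exact: one.
(* Both ends are off c: prolong a path from y that avoids x. *)
have neq_yx : y != x by apply: contraTneq xy => ->; rewrite e_irr.
have [z zc] : exists z, z \in c.
  by case: c c_gt2 => // z p _; exists z; rewrite mem_head.
have [|||s [w [ysw lts sX]]] := @attachment_avoiding [set x] y z yNc _ _ zc.
- by rewrite inE.
- by rewrite cards1; move: k_large a_gt0; clear; lia.
- by rewrite inE; apply: contraNneq xNc => <-.
have xsw : attaches x (y :: s) w.
  have [se Us sNc wc _] := ysw; split=> //; first by rewrite /= xy.
    rewrite cons_uniq Us andbT inE negb_or eq_sym neq_yx /=.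
    by apply/negP=> xs; have := sX x; rewrite mem_rcons !inE xs orbT eqxx => /(_ isT).
  by move: sNc; rewrite /= => sNc; rewrite negb_or xNc.
rewrite (out_c _ _ _ xsw) (out_c _ _ _ ysw) /attached_value /=.
by rewrite -(addbA (g x y)) addbK.
Qed.

End Potential.

(** * Incidence vectors as label sums *)

Section IncidenceSums.
Variables (T : finType) (e : rel T).

(** Subtracting the projection onto the smaller span and reading off a
coordinate where the result does not vanish gives a linear functional;
[lab] holds its values on single edges. *)
Lemma span_separation (C C' : {set {set edge e}}) :
    ~~ (incidence_span C' <= incidence_span C)%VS ->
  exists lab : edge e -> bool,
    {in C, forall F : {set edge e}, \big[addb/false]_(A in F) lab A = false} /\
    exists2 F : {set edge e}, F \in C' & \big[addb/false]_(A in F) lab A.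
Proof.
move=> NsubU; have [F FC' FNU] : exists2 F,
    F \in C' & incidence F \notin incidence_span C.
  apply/exists_inP; apply: contraR NsubU; rewrite negb_exists_in => /forall_inP sub.
  apply/span_subvP => _ /mapP[F + ->]; rewrite mem_enum => /sub.
  by rewrite negbK.
set U := incidence_span C in FNU.
pose w := (incidence F - projv U (incidence F))%R.
have [A0 wA0] : exists A, w A != 0%R.
  apply/existsP; apply: contraR FNU; rewrite negb_exists => /forallP w0.
  suff -> : incidence F = projv U (incidence F) by apply: memv_proj.
  apply/eqP; rewrite -GRing.subr_eq0; apply/eqP/ffunP=> A.
  by have := w0 A; rewrite negbK [RHS]ffunE => /eqP.
pose phi (x : {ffun edge e -> ('F_2)^o}) : 'F_2 := (x - projv U x)%R A0.
have phi0 : phi 0%R = 0%R by rewrite /phi GRing.linear0 GRing.subrr ffunE.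
have phiD : {morph phi : x y / (x + y)%R}.
  by move=> x y; rewrite /phi GRing.linearD GRing.opprD GRing.addrACA ffunE.
have nzD : {morph (fun z : 'F_2 => z != 0%R) : x y / (x + y)%R >-> x (+) y}.
  by case=> [[|[|i]] ?] [[|[|j]] ?].
have incD (G : {set edge e}) : incidence G = (\sum_(A in G) incidence [set A])%R.
  apply/ffunP=> A; rewrite sum_ffunE ffunE; under eq_bigr do rewrite ffunE inE.
  case: (boolP (A \in G)) => AG.
    rewrite (bigD1 A) //= eqxx big1 ?GRing.addr0 // => B /andP[_ BA].
    by rewrite eq_sym (negbTE BA).
  rewrite big1 // => B BG; case: eqP => // AB.
  by rewrite AB BG in AG.
exists (fun A => phi (incidence [set A]) != 0%R).
have sumE (G : {set edge e}) :
    \big[addb/false]_(A in G) (phi (incidence [set A]) != 0%R) =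
    (phi (incidence G) != 0%R).
  by rewrite incD (big_morph phi phiD phi0) (big_morph _ nzD (_ : _ = false)) ?eqxx.
split=> [G GC|]; last by exists F; rewrite // sumE.
rewrite sumE; apply/negbTE; rewrite negbK /phi projv_id ?GRing.subrr ?ffunE //.
by apply/memv_span/map_f; rewrite mem_enum.
Qed.

Lemma big_next (f : T -> T -> bool) (c : seq T) : uniq c ->
  \big[addb/false]_(x <- c) f x (next c x) = cycle_sum f c.
Proof.
case: c => [|x0 p] /=; first by rewrite big_nil.
suff aux z y : uniq (y :: p) ->
    \big[addb/false]_(x <- y :: p) f x (next_at x z y p) =
    walk_sum f y (rcons p z) by exact: aux.
elim: p y => [|t p IHp] y Uy; first by rewrite big_seq1 /= eqxx addbF.
rewrite big_cons /= eqxx; congr addb; case/andP: Uy => yNp Up.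
rewrite -IHp //; apply: eq_big_seq => x xp /=.
by case: eqP => // xy; rewrite -xy xp in yNp.
Qed.

(** Pairs that are not edges get the label 0, so that the label is defined, and
symmetric, on all pairs. *)
Definition edge_label (lab : edge e -> bool) x y :=
  oapp lab false (insub [set x; y]).

Lemma edge_label_sym lab : symmetric (edge_label lab).
Proof. by move=> x y; rewrite /edge_label setUC. Qed.

(** Hence a cycle does not traverse an edge back and forth, and its edges are
as many as its vertices. *)
Lemma next_next_neq (c : seq T) x :
  uniq c -> 2 < size c -> x \in c -> next c (next c x) != x.
Proof.
move=> Uc c_gt2 xc; have [i p defc] := rot_to xc.
rewrite -!(next_rot i Uc) defc; have := size_rot i c; have := rot_uniq i c.
rewrite defc Uc; case: p {defc} => [|y [|z p]] /= Up sz; rewrite -?sz // in c_gt2.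
move: Up; rewrite !inE !negb_or eqxx; case/and4P=> /and3P[xy xz _] _ _ _.
by rewrite [y == x]eq_sym (negbTE xy) /= eqxx eq_sym.
Qed.

Lemma cycle_edges_sum (lab : edge e -> bool) (c : seq T) : graph_cycle e c ->
  \big[addb/false]_(A in cycle_edges e c) lab A = cycle_sum (edge_label lab) c.
Proof.
case/andP=> c_gt2 /andP[_ Uc]; rewrite -big_next //.
pose s := [seq [set x; next c x] | x <- c].
have Us : uniq s.
  rewrite map_inj_in_uniq // => x y xc yc /setP eq_xy.
  have := eq_xy x; rewrite !inE eqxx /= => /esym/orP[/eqP//|/eqP x_ny].
  have := eq_xy y; rewrite !inE eqxx /= => /orP[/eqP//|/eqP y_nx].
  by have := next_next_neq Uc c_gt2 xc; rewrite -y_nx -x_ny eqxx.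
transitivity (\big[addb/false]_(B <- s) oapp lab false (insub B)); last first.
  by rewrite big_map.
rewrite -big_pmap big_uniq ?pmap_sub_uniq //=; apply: eq_bigl => A.
by rewrite inE mem_pmap_sub.
Qed.

End IncidenceSums.

(** * Hamilton cycles span the cycle space *)

Theorem theorem1p6 (T : finType) (e : rel T)
    (e_sym : symmetric e) (e_irr : irreflexive e)
    (n : nat) (card_T : #|T| = n) (n_odd : odd n)
    (D : 'I_(16 * independence_number e + 12) -> {set T})
    (D_cds : forall i, connected_dominating e (D i))
    (D_disj : forall i j, i != j -> [disjoint D i & D j]) :
  cycle_space_of_length e n = cycle_space e.
Proof.
apply/eqP; rewrite eqEsubv; apply/andP; split.
  apply: sub_span => _ /mapP[F + ->]; rewrite mem_enum => FC.
  apply: map_f; rewrite mem_enum; apply/bigcupP.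
  have lt_n : n < #|T|.+1 by rewrite card_T.
  by exists (Ordinal lt_n).
(* From here on, a label separates the Hamilton cycles from the cycle F. *)
apply/negPn/negP=> /span_separation[lab [lab_ham [F FC labF]]].
set f := edge_label lab; have f_sym : symmetric f := edge_label_sym lab.
have [c0 c0P defF] := cyclesP F FC.
have /andP[c0_gt2 /andP[ec0 Uc0]] := c0P.
have fc0 : cycle_sum f c0 by rewrite -cycle_edges_sum // -defF.
have [c [ec Uc c_gt2 fc c_short]] :=
  short_odd_cycle e_sym e_irr f_sym ec0 Uc0 c0_gt2 fc0.
have f_ham h : cycle e h -> uniq h -> size h = #|T| -> cycle_sum f h = false.
  move=> eh Uh szh; have gh : graph_cycle e h.
    rewrite /graph_cycle /ucycleb eh Uh szh !andbT.
    by apply: leq_trans c_gt2 _; rewrite -(card_uniqP Uc) max_card.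
  rewrite -cycle_edges_sum //; apply: lab_ham; apply/imsetP.
  have szn : size h == n by rewrite szh card_T.
  by exists (Tuple szn); rewrite ?inE.
have f_even := even_cycle_sum e_sym e_irr D_cds D_disj f_sym f_ham.
have le16 : 16 * independence_number e <= 16 * independence_number e + 12.
  exact: leq_addr.
have a_gt0 : 0 < independence_number e by move: c_gt2 c_short; clear; lia.
have odd_c : odd (size c).
  apply: contraTT fc => even_c; rewrite (f_even c le16 ec Uc even_c) //.
  by move: a_gt0 c_short; clear; lia.
pose g x y := ~~ f x y.
have g_sym : symmetric g by move=> x y; rewrite /g f_sym.
have gE d : cycle_sum g d = cycle_sum f d (+) odd (size d).
  by case: d => //= x p; rewrite walk_sum_negb size_rcons.
have g_even d : cycle e d -> uniq d -> ~~ odd (size d) ->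
    size d <= 10 * independence_number e -> cycle_sum g d = false.
  move=> ed Ud even_d le_d; rewrite gE (negbTE even_d) addbF.
  exact: f_even.
have gc : cycle_sum g c = false by rewrite gE fc odd_c.
have conn := connected_avoiding e_sym D_cds D_disj.
have k_large : 4 * independence_number e < 16 * independence_number e + 12.
  by clear; lia.
have [h hP] := cycle_potential Uc gc.
have [p gp] := potential_extends e_sym e_irr conn k_large g_sym g_even
  ec Uc c_gt2 odd_c c_short hP.
have closed_walk d : cycle e d -> cycle_sum g d = false.
  case: d => //= x q exq; rewrite (@walk_sum_potential _ _ p).
    by rewrite last_rcons addbb.
  by apply: sub_path exq => u v uv; apply/eqP/gp.
have [x [y exy]] : exists x y, e x y.
  case: c ec c_gt2 {Uc fc c_short odd_c gc hP} => [//|x [//|y q]] /= /andP[exy _] _.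
  by exists x, y.
have neq_xy : x != y by apply: contraTneq exy => ->; rewrite e_irr.
(* A Hamilton path between adjacent vertices closes up to a Hamilton cycle,   *)
(* whose odd length makes its g-sum differ from its f-sum.                    *)
have [X leX|P [eP UP _ hd lst] PT] :=
  chvatal_erdos e_sym e_irr (in_setT x) (in_setT y) neq_xy.
  rewrite setTD; apply: conn; apply: leq_ltn_trans leX _.
  by clear; lia.
have eP' : cycle e P.
  case: P eP hd lst {UP PT} => //= z q ezq zx lq.
  by rewrite rcons_path ezq lq zx e_sym.
have szP : size P = #|T|.
  by rewrite -(card_uniqP UP); apply: eq_card => z; rewrite PT ?inE.
by have := closed_walk P eP'; rewrite gE f_ham // szP card_T n_odd.
Qed.
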